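(* Let $d\ge1$, $\sigma\in\mathbb N$ with $\sigma\ge d+1$, and let $g=\begin{pmatrix} a&\mathbf b^t\\ \mathbf c& D\end{pmatrix}\in \mathrm{SU}(1,d)$ with $a,b_i,c_i\neq0$ for $i=1,\dots,d$. Let $p_i=b_i/a$, $\tilde p_i=c_i/a$, $U_{i,j}=\frac{aD_{j,i}}{b_ic_j}$ for $1\le i,j\le d$, and let $p_0$ satisfy $|p_0|^2=|a|^{-2}$. For $k=1,\dots,d$ and all $\mathbf m,\mathbf n\in\mathbb N_0^d$, the Meixner polynomials $M_{\mathbf m}(\mathbf n)=M_{\mathbf m}(\mathbf n;U,\sigma)$ satisfy $$\left|\tfrac{p_0}{p_k}\right|^2n_kM_{\mathbf m}(\mathbf n)=\Big(\sigma+|\mathbf m|+\sum_{i=1}^d|U_{k,i}\tilde p_i|^2m_i\Big)M_{\mathbf m}(\mathbf n)+\sum_{\substack{i,j=1\\ i\ne j}}^d\overline{U_{k,i}}\,U_{k,j}|\tilde p_i|^2m_jM_{\mathbf m-\mathbf v_j+\mathbf v_i}(\mathbf n)$$ $$-\sum_{i=1}^dU_{k,i}m_iM_{\mathbf m-\mathbf v_i}(\mathbf n)-(\sigma+|\mathbf m|)\sum_{i=1}^d\overline{U_{k,i}}\,|\tilde p_i|^2M_{\mathbf m+\mathbf v_i}(\mathbf n).$$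
   Context: Notation: $\mathbb N_0=\{0,1,2,\dots\}$. For $\mathbf x\in\mathbb C^d$: $|\mathbf x|=x_1+\cdots+x_d$ (plain sum). For $\mathbf n\in\mathbb N_0^d$: $\mathbf n!=n_1!\cdots n_d!$, $\mathbf x^{\mathbf n}=x_1^{n_1}\cdots x_d^{n_d}$. $(\beta)_n=\beta(\beta+1)\cdots(\beta+n-1)$. $\mathbf v_i$ is the $i$-th standard basis vector ($i$-th entry $1$, other entries $0$) of length $d$. Terms in which a polynomial's index has a negative entry carry a factor $0$ and are read as $0$. Group: $J=\mathrm{diag}(1,-1,\ldots,-1)$ of size $d+1$; $\mathrm{SU}(1,d)=\{g\in \mathrm{SL}(d+1,\mathbb C): g^\dagger Jg=J\}$. Elements are written in block form $g=\begin{pmatrix} a&\mathbf b^t\\ \mathbf c& D\end{pmatrix}$ with $a\in\mathbb C$, $\mathbf b,\mathbf c\in\mathbb C^d$, $D$ a complex $d\times d$ matrix. Multivariate Meixner polynomials: for $\beta\in\mathbb C\setminus(-\mathbb N_0)$ and a complex $d\times d$ matrix $U=(U_{i,j})$, $M_{\mathbf n}(\mathbf x;U,\beta)$ ($\mathbf n\in\mathbb N_0^d$, $\mathbf x\in\mathbb C^d$) is defined by $$\Big(1-\sum_{j=1}^dt_j\Big)^{-\beta-|\mathbf x|}\prod_{i=1}^d\Big(1-\sum_{j=1}^dU_{i,j}t_j\Big)^{x_i}=\sum_{\mathbf n\in\mathbb N_0^d}\frac{(\beta)_{|\mathbf n|}}{\mathbf n!}M_{\mathbf n}(\mathbf x;U,\beta)\,\mathbf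 t^{\mathbf n}$$ for $\mathbf t\in\mathbb C^d$ sufficiently close to $0$ (principal branches of powers). *)

(* Defs.v *)
From HB Require Import structures.
From mathcomp Require Import all_boot all_order all_algebra.
From mathcomp Require Import complex sesquilinear spectral.
From mathcomp Require Import all_classical all_reals all_analysis.
From mathcomp.analysis Require Import showcase.summability.

Set Implicit Arguments.
Unset Strict Implicit.
Unset Printing Implicit Defensive.
Import Order.TTheory GRing.Theory Num.Theory numFieldNormedType.Exports.
Local Open Scope classical_set_scope.
Local Open Scope ring_scope.
Local Open Scope complex_scope.
Local Open Scope sesquilinear_scope.

(* R[i] has no topology in the libraries; it gets the one of the norm `|_|
   that every numFieldType R carries on R^o. *)
HB.instance Definition _ (R : rcfType) :=
  NormedModule.copy R[i] (R[i] : numFieldType)^o.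

Section PrincipalPower.
Variable R : realType.

Definition cexp (z : R[i]) : R[i] :=
  let: x +i* y := z in (expR x * cos y) +i* (expR x * sin y).

Definition cabs (w : R[i]) : R :=
  let: x +i* y := w in Num.sqrt (x ^+ 2 + y ^+ 2).

(* Principal argument, with values in ]-pi, pi] (unspecified at 0). *)
Definition carg (w : R[i]) : R :=
  let: x +i* y := w in
  if 0 <= y then acos (x / cabs w) else - acos (x / cabs w).

Definition clog (w : R[i]) : R[i] := ln (cabs w) +i* carg w.

(* Principal branch of w ^ z, for w != 0. *)
Definition cpow (w z : R[i]) : R[i] := cexp (z * clog w).

End PrincipalPower.

Section MultiIndex.
Variable d : nat.

Definition multiidx := {ffun 'I_d -> nat}.

Definition midx_sum (n : multiidx) : nat := (\sum_i n i)%N.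

Definition midx_fact (n : multiidx) : nat := (\prod_i (n i)`!)%N.

Definition midx_add1 (n : multiidx) (i : 'I_d) : multiidx :=
  [ffun l => (n l + (l == i))%N].

(* The subtraction is truncated: midx_sub1 n i is n - v_i only if 0 < n i. *)
Definition midx_sub1 (n : multiidx) (i : 'I_d) : multiidx :=
  [ffun l => (n l - (l == i))%N].

End MultiIndex.

Section Meixner.
Variables (R : realType) (d : nat).
Local Notation C := R[i].

Definition pochhammer (beta : C) (n : nat) : C :=
  \prod_(0 <= k < n) (beta + k%:R).

Definition meixner_genfun (U : 'M[C]_d) (beta : C) (x t : 'rV[C]_d) : C :=
  cpow (1 - \sum_j t 0 j) (- beta - \sum_i x 0 i) *
  \prod_i cpow (1 - \sum_j U i j * t 0 j) (x 0 i).

Definition meixner_term (beta : C) (M : multiidx d -> 'rV[C]_d -> C)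
    (x t : 'rV[C]_d) (n : multiidx d) : C :=
  pochhammer beta (midx_sum n) / (midx_fact n)%:R * M n x *
  \prod_i t 0 i ^+ n i.

(* M n x = M_n(x; U, beta), for beta outside {0, -1, -2, ...}: then the factors
   (beta)_|n| / n! are nonzero and the expansion, an unordered sum over all
   multi-indices, determines M. *)
Definition is_meixner (U : 'M[C]_d) (beta : C)
    (M : multiidx d -> 'rV[C]_d -> C) : Prop :=
  forall x : 'rV[C]_d, \forall t \near (0 : 'rV[C]_d),
    partial_sum (meixner_term beta M x t) @ totally -->
      meixner_genfun U beta x t.

Definition midx_point (n : multiidx d) : 'rV[C]_d := \row_i (n i)%:R.

Definition J1d : 'M[C]_(1 + d) := block_mx 1%:M 0 0 (- 1%:M).

Definition in_SU1d (g : 'M[C]_(1 + d)) : Prop :=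
  \det g = 1 /\ g ^t* *m J1d *m g = J1d.

End Meixner.

Arguments J1d {R d}.

(* Main.v *)
Require Import Defs.
From HB Require Import structures.
From mathcomp Require Import all_boot all_order all_algebra.
From mathcomp Require Import finmap complex ring.
From mathcomp Require Import all_classical all_reals all_analysis.
From mathcomp.analysis Require Import showcase.summability.
Import Order.TTheory GRing.Theory Num.Theory numFieldNormedType.Exports.
Local Open Scope ring_scope.

(** Since both the parameter sigma and the point n are integral, the generating
    function at x = n is the rational function
      G(t) = S(t)^-N * \prod_l L_l(t)^n_l,  N = sigma + |n|,
    with S = 1 - \sum_j t_j and L_l = 1 - \sum_j U_lj t_j.  Fix k and put
    w_j = conj(U_kj) |ptilde_j|^2.  The relations between the columns of an
    element of SU(1,d) say exactly that \sum_j w_j = 1 and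
    \sum_j U_lj w_j = 1 + kappa [l = k] with kappa = |p0 / p_k|^2.  Hence the
    derivation Delta = \sum_j (t_j - w_j) d/dt_j satisfies Delta S = S and
    Delta L_l = L_l + kappa [l = k]: every factor of G is an eigenfunction of
    Delta, except for the constant kappa produced by L_k.  The logarithmic
    derivative of G therefore gives
      L_k (Delta + sigma) G = kappa n_k G,
    and the stated recurrence is the coefficient of t^m in this equation, divided
    by (sigma)_|m| / m!.

    The computation is carried out on coefficient families indexed by
    multi-indices, where multiplication by 1 - \sum_j u_j t_j is the operator
    [affine u] and Delta is [euler_drift w]; their commutator
    ([euler_drift_affine]) leads to [drift_eq_of_product], the coefficient form of
    the differential equation.  Its premise S^N A = \prod_l L_l^n_l, for the
    coefficients A of G, avoids dividing power series.  It is obtained from the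
    analytic definition of the polynomials: products with affine functions act on
    unordered expansions as they act on coefficients ([expands_affine]), and an
    expansion of 0 near the origin has zero coefficients
    ([expands_unique0]). *)

Set Implicit Arguments.
Unset Strict Implicit.
Unset Printing Implicit Defensive.

(** * Arithmetic of multi-indices *)

Section MultiIndexArith.
Variable d : nat.
Implicit Types (m : multiidx d) (i j : 'I_d).

Lemma midx_add1K m i : midx_sub1 (midx_add1 m i) i = m.
Proof. by apply/ffunP => l; rewrite !ffunE addnK. Qed.

Lemma midx_sub1K m i : (0 < m i)%N -> midx_add1 (midx_sub1 m i) i = m.
Proof.
move=> mi; apply/ffunP => l; rewrite !ffunE subnK //.
by case: eqP => [->|].
Qed.

Lemma midx_sub1C m i j :
  midx_sub1 (midx_sub1 m i) j = midx_sub1 (midx_sub1 m j) i.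
Proof. by apply/ffunP => l; rewrite !ffunE subnAC. Qed.

Lemma midx_add_sub1 m i j : i != j ->
  midx_sub1 (midx_add1 m j) i = midx_add1 (midx_sub1 m i) j.
Proof.
move=> ij; apply/ffunP => l; rewrite !ffunE.
by have [->|_] := eqVneq l i; rewrite ?(negPf ij) ?addn0 ?subn0.
Qed.

Lemma midx_sum_add1 m i : midx_sum (midx_add1 m i) = (midx_sum m).+1.
Proof.
rewrite /midx_sum -addn1; under eq_bigr do rewrite ffunE.
rewrite big_split /=; congr addn.
rewrite (bigD1 i) //= eqxx big1 ?addn0 // => l li.
by rewrite (negPf li).
Qed.

Lemma midx_sum_sub1 m i : (0 < m i)%N ->
  midx_sum m = (midx_sum (midx_sub1 m i)).+1.
Proof. by move=> mi; rewrite -(midx_sum_add1 _ i) midx_sub1K. Qed.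

Lemma midx_fact_add1 m i :
  midx_fact (midx_add1 m i) = ((m i).+1 * midx_fact m)%N.
Proof.
rewrite /midx_fact (bigD1 i) // [in RHS](bigD1 i) //= mulnA ffunE eqxx addn1.
rewrite factS; congr muln; apply: eq_bigr => l li.
by rewrite ffunE (negPf li) addn0.
Qed.

Lemma midx_fact_gt0 m : (0 < midx_fact m)%N.
Proof. by rewrite prodn_gt0 // => i; rewrite fact_gt0. Qed.

End MultiIndexArith.

(** * Operators on coefficient families *)

Section FormalSeries.
Variables (K : comNzRingType) (d : nat).
Local Notation series := (multiidx d -> K^o).
Implicit Types (A B : series) (m : multiidx d) (u v w : 'I_d -> K).

(** Multiplication by the variable t_j, on coefficients. *)
Definition mulX (j : 'I_d) A : series :=
  fun m => if (0 < m j)%N then A (midx_sub1 m j) else 0.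

(** Multiplication by 1 - \sum_j u_j t_j, on coefficients. *)
Definition affine u A : series :=
  fun m => A m - \sum_j u j * mulX j A m.

(** The derivation \sum_j (t_j - w_j) d/dt_j, on coefficients: the Euler part
    \sum_j t_j d/dt_j is diagonal with eigenvalue |m|. *)
Definition euler_drift w A : series := fun m =>
  (midx_sum m)%:R * A m - \sum_j w j * (m j).+1%:R * A (midx_add1 m j).

Definition one_series : series := fun m => (midx_sum m == 0%N)%:R.

Lemma mulX_linear j : linear (mulX j : series -> series).
Proof.
move=> x A B; apply/funext => m.
change (mulX j (fun l => x * A l + B l) m = x * mulX j A m + mulX j B m).
by rewrite /mulX; case: ifP => // _; rewrite mulr0 addr0.
Qed.
HB.instance Definition _ j := GRing.isLinear.Build K _ _ _ _ (mulX_linear j).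

Lemma affine_linear u : linear (affine u : series -> series).
Proof.
move=> x A B; apply/funext => m.
change (affine u (x *: A + B) m = x * affine u A m + affine u B m).
rewrite /affine; under eq_bigr => j _.
  rewrite linearP (_ : _ m = x * mulX j A m + mulX j B m) // mulrDr mulrCA.
  over.
rewrite big_split /= -mulr_sumr opprD.
by rewrite (_ : _ m = x * A m + B m) // mulrBr addrACA.
Qed.
HB.instance Definition _ u := GRing.isLinear.Build K _ _ _ _ (affine_linear u).

Lemma euler_drift_linear w :
  linear (euler_drift w : series -> series).
Proof.
move=> x A B; apply/funext => m.
change (euler_drift w (fun l => x * A l + B l) m =
        x * euler_drift w A m + euler_drift w B m).
rewrite /euler_drift; under eq_bigr do rewrite mulrDr mulrCA.
by rewrite big_split /= -mulr_sumr opprD mulrDr mulrBr addrACA mulrCA.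
Qed.
HB.instance Definition _ w := GRing.isLinear.Build K _ _ _ _ (euler_drift_linear w).

Lemma mulXC i j A : mulX i (mulX j A) = mulX j (mulX i A).
Proof.
apply/funext => m; rewrite /mulX !ffunE midx_sub1C.
have [->//|ij] := eqVneq i j.
by rewrite !subn0; case: (0 < m i)%N; case: (0 < m j)%N.
Qed.

Lemma affineE u A : affine u A = A - \sum_j u j *: mulX j A.
Proof.
apply/funext => m; rewrite /affine !fctE; congr (_ - _).
by rewrite fct_sumE.
Qed.

Lemma mulX_affine j u A : mulX j (affine u A) = affine u (mulX j A).
Proof.
rewrite !affineE linearB linear_sum; congr (_ - _).
by apply: eq_bigr => i _; rewrite linearZ /= mulXC.
Qed.

Lemma affineC u v A : affine u (affine v A) = affine v (affine u A).
Proof.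
rewrite [in LHS](affineE v) [in RHS](affineE v) linearB linear_sum /=.
by congr (_ - _); apply: eq_bigr => j _; rewrite linearZ /= mulX_affine.
Qed.

(** Multiplication by a power series with constant term 1: the coefficients of
    the other factor are determined by induction on their degree. *)
Lemma affine_inj u : injective (affine u).
Proof.
move=> A B /eqP; rewrite -subr_eq0 -linearB => /eqP.
set X := A - B => hX; suff X0 : X = 0 by apply/eqP; rewrite -subr_eq0 -/X X0.
suff : forall n m, midx_sum m = n -> X m = 0.
  by move=> h; apply/funext => m; exact: h.
elim=> [|n IHn] m hm.
all: have /eqP := congr1 (fun f => f m) hX; rewrite /affine subr_eq0 => /eqP ->.
all: rewrite big1 // => j _; rewrite /mulX; case: ifP => [mj|_]; rewrite ?mulr0 //.
all: move: hm; rewrite (midx_sum_sub1 mj) // => -[hm].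
by rewrite IHn ?mulr0.
Qed.

(** The Leibniz rule, as the derivation sends t_j to t_j - w_j. *)
Lemma euler_drift_mulX w j A :
  euler_drift w (mulX j A) = mulX j (euler_drift w A) + mulX j A - w j *: A.
Proof.
apply/funext => m.
change (euler_drift w (mulX j A) m =
        mulX j (euler_drift w A) m + mulX j A m - w j * A m).
rewrite /euler_drift (bigD1 j) //=.
have -> : mulX j A (midx_add1 m j) = A m.
  by rewrite /mulX ffunE eqxx addn1 midx_add1K.
under eq_bigr => i ij.
  have -> : mulX j A (midx_add1 m i) =
            if (0 < m j)%N then A (midx_add1 (midx_sub1 m j) i) else 0.
    by rewrite /mulX ffunE [j == i]eq_sym (negPf ij) addn0 midx_add_sub1 // eq_sym.
  over.
rewrite /mulX; case: ifPn => mj; last first.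
  rewrite big1 => [|i _]; last by rewrite mulr0.
  move: mj; rewrite -eqn0Ngt => /eqP ->; rewrite mulr0 !addr0 !add0r mulr1.
  by rewrite /GRing.scale.
rewrite [in RHS](bigD1 j) //= midx_sub1K // (midx_sum_sub1 mj).
rewrite ffunE eqxx subn1 prednK //.
have -> : \sum_(i < d | i != j) w i * (midx_sub1 m j i).+1%:R *
             A (midx_add1 (midx_sub1 m j) i) =
          \sum_(i < d | i != j) w i * (m i).+1%:R *
             A (midx_add1 (midx_sub1 m j) i).
  by apply: eq_bigr => i ij; rewrite ffunE (negPf ij) subn0.
rewrite -!natr1; ring.
Qed.

(** The Leibniz rule again: the derivation sends L = 1 - \sum_j u_j t_j to
    L - (1 - \sum_j u_j w_j). *)
Lemma euler_drift_affine w u A :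
  euler_drift w (affine u A) =
    affine u (euler_drift w A) + affine u A - (1 - \sum_j u j * w j) *: A.
Proof.
rewrite !affineE linearB linear_sum /=.
under eq_bigr do rewrite linearZ /= euler_drift_mulX scalerBr scalerDr scalerA.
rewrite sumrB big_split /= -scaler_suml scalerBl scale1r.
set X := euler_drift w A; set Y := \sum_j _; set Z := \sum_j _; set V := _ *: A.
by rewrite !opprD !opprK -!addrA [A + _]addrCA addNKr.
Qed.

Lemma euler_drift_one w : euler_drift w one_series = 0.
Proof.
apply/funext => m; rewrite /euler_drift /one_series big1 ?subr0.
  by case: (midx_sum m) => [|n]; rewrite ?mul0r ?mulr0.
by move=> j _; rewrite midx_sum_add1 mulr0.
Qed.

(* Under the two hypotheses below the derivation fixes S = affine 1 and sends
   L_l = affine (U l) to L_l + kappa [l = k]. *)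
Section PowerProduct.
Variables (w : 'I_d -> K) (U : 'M[K]_d) (kappa : K) (k : 'I_d).
Hypothesis w1 : \sum_j w j = 1.
Hypothesis Uw : forall l, \sum_j U l j * w j = 1 + kappa *+ (l == k).

Local Notation S := (affine (fun=> 1 : K)).

Lemma iter_affineC N u A :
  iter N S (affine u A) = affine u (iter N S A).
Proof. by elim: N => //= N ->; rewrite affineC. Qed.

Lemma iter_affine_linear N : linear (iter N S : series -> series).
Proof. by elim: N => // N IHN x A B; rewrite !iterS IHN linearP. Qed.

HB.instance Definition _ N :=
  GRing.isLinear.Build K series series _ _ (iter_affine_linear N).

Lemma iter_affine_inj N : injective (iter N S : series -> series).
Proof. by elim: N => [|N IHN] A B //= /affine_inj /IHN. Qed.

Lemma euler_drift_iter N A :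
  euler_drift w (iter N S A) = iter N S (euler_drift w A) + iter N S A *+ N.
Proof.
elim: N => [|N IHN]; first by rewrite addr0.
rewrite !iterS euler_drift_affine IHN linearD linearMn.
under eq_bigr do rewrite mul1r.
by rewrite w1 subrr scale0r subr0 -addrA -mulrSr.
Qed.

(** The coefficients of \prod_(l <- s) L_l; an exponent is a multiplicity in the
    list s, which turns the Leibniz rule into an induction on s. *)
Definition affine_prod (s : seq 'I_d) : series :=
  foldr (fun l => affine (U l)) one_series s.

(** Each factor L_l of the product contributes the product itself, and each
    factor L_k contributes kappa times the product with that factor removed;
    multiplication by L_k restores it. *)
Lemma affine_euler_drift_prod s :
  affine (U k) (euler_drift w (affine_prod s)) =
    affine (U k) (affine_prod s) *+ size s
    + kappa *: affine_prod s *+ count_mem k s.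
Proof.
elim: s => [|l s IHs] /=; first by rewrite euler_drift_one linear0 !addr0.
rewrite euler_drift_affine Uw (opprD 1) (addrA 1) subrr sub0r scaleNr opprK.
rewrite 2!linearD /= affineC IHs linearD /= 2!linearMn /= 2!linearZ /=.
rewrite (affineC (U k) (U l)) mulrS mulrnDr.
by have [->|_] := eqVneq l k; rewrite ?mulr1n ?mulr0n ?scale0r -addrA addrACA;
  congr (_ + _); exact: addrC.
Qed.

(** The differential equation L_k (Delta + sigma) G = kappa n_k G for
    G = S^-N \prod_(l <- s) L_l.  Both sides are compared after multiplication by
    S^N, which is injective; Delta S = S makes the exponent N = sigma + size s
    of S^N cancel against sigma and the size s factors of the product. *)
Lemma drift_eq_of_product sigma s A :
  iter (sigma + size s) S A = affine_prod s ->
  affine (U k) (euler_drift w A + A *+ sigma) = kappa *: A *+ count_mem k s.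
Proof.
move=> hA; apply: (@iter_affine_inj (sigma + size s)).
have hD : iter (sigma + size s) S (euler_drift w A + A *+ sigma) =
          euler_drift w (affine_prod s) - affine_prod s *+ size s.
  have /eqP := euler_drift_iter (sigma + size s) A.
  rewrite hA -subr_eq => /eqP hD.
  by rewrite linearD linearMn /= hA -hD mulrnDr opprD addrAC addrA addrK.
rewrite iter_affineC hD linearB /= linearMn /= affine_euler_drift_prod.
rewrite addrAC subrr add0r.
by rewrite [RHS]linearMn /= [X in _ = X *+ _]linearZ /= hA.
Qed.

End PowerProduct.

End FormalSeries.

(** * Unordered sums of complex numbers *)

#[local] Existing Instance totally_filter.

Section UnorderedSums.
Local Open Scope classical_set_scope.
Variables (R : realType).
Local Notation C := R[i].

Lemma partial_sumE (I : choiceType) (a : I -> C) (X : {fset I}) :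
  partial_sum a X = \sum_(i <- X) a i.
Proof. by rewrite /partial_sum big_seq_fsetE. Qed.

(** A finite partial sum over X is one over the union of X with a set X0 past
    which the sums are within 1 of the limit, minus a sum over a part of X0. *)
Lemma partial_sum_bounded (I : choiceType) (a : I -> C) (l : C) :
  partial_sum a @ totally --> l ->
  exists2 B, 0 < B & forall X : {fset I}, `|\sum_(i <- X) a i| <= B.
Proof.
move=> /cvgrPdist_lt /(_ 1 ltr01) [X0 _ hX0].
exists (`|l| + 1 + \sum_(i <- X0) `|a i|).
  by rewrite ltr_pwDl ?sumr_ge0 // ltr_wpDl.
move=> X.
have /hX0 /= : [set Y | (X0 `<=` Y)%fset]%classic (X `|` X0)%fset.
  exact: fsubsetUr.
rewrite partial_sumE.
have -> : \sum_(i <- (X `|` X0)%fset) a i =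
          \sum_(i <- X) a i + \sum_(i <- [fset i in X0 | i \notin X]%fset) a i.
  rewrite (big_fsetID _ (mem X)) /=; congr (_ + _); apply: eq_fbigl => i;
    rewrite !inE /=; case: (i \in X); rewrite ?andbT ?andbF ?orbT //=.
set s := \sum_(i <- X) _; set r := \sum_(i <- _) _ => hs.
have hr : `|r| <= \sum_(i <- X0) `|a i|.
  rewrite (le_trans (ler_norm_sum _ _ _)) // big_fset /=.
  by rewrite big_mkcond /= ler_sum // => i _; case: ifP.
have -> : s = l - (l - (s + r)) - r by ring.
rewrite (le_trans (ler_normB _ _)) // lerD //.
by rewrite (le_trans (ler_normB _ _)) // lerD // ltW.
Qed.

(** A sum with weights in [0, 1] is a convex combination of its subset sums.
    This is the substitute for absolute convergence: weighted sums are bounded by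
    the bound on plain partial sums. *)
Lemma norm_convex_sum_le (I : choiceType) (a phi : I -> C) (B x0 : C)
    (s : seq I) :
  (forall i, 0 <= phi i <= 1) ->
  (forall s', subseq s' s -> `|x0 + \sum_(i <- s') a i| <= B) ->
  `|x0 + \sum_(i <- s) phi i * a i| <= B.
Proof.
move=> hphi; elim: s x0 => [|i s IHs] x0 hs.
  by have := hs [::] (subseq_refl _); rewrite !big_nil.
have /andP[p0 p1] := hphi i; rewrite big_cons.
have h0 : `|x0 + \sum_(j <- s) phi j * a j| <= B.
  apply: IHs => s' s's; apply: hs.
  exact: subseq_trans s's (subseq_cons _ _).
have h1 : `|x0 + a i + \sum_(j <- s) phi j * a j| <= B.
  apply: IHs => s' s's; have := hs (i :: s').
  by rewrite big_cons addrA; apply; rewrite /= eqxx.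
set y := \sum_(j <- s) _ in h0 h1 *.
have -> : x0 + (phi i * a i + y) =
    (1 - phi i) * (x0 + y) + phi i * (x0 + a i + y) by ring.
have -> : B = (1 - phi i) * B + phi i * B by ring.
rewrite (le_trans (ler_normD _ _)) // !normrM lerD //.
  by rewrite ger0_norm ?subr_ge0 // ler_wpM2l // subr_ge0.
by rewrite (ger0_norm p0) ler_wpM2l.
Qed.

(** If \sum_i a_i z^(wt i) vanishes for all z in ]0, 1] and i1 is the only index
    of minimal weight among the nonzero terms, then after division by z^(wt i1)
    the other terms are O(z), because z^(wt i - wt i1 - 1) is a weight in [0, 1].
    A small enough z then contradicts a_i1 <> 0. *)
Lemma leading_coef_eq0 (I : choiceType) (a : I -> C) (wt : I -> nat) (i1 : I) :
  (forall i, i != i1 -> a i != 0 -> (wt i1 < wt i)%N) ->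
  (forall z : C, 0 < z <= 1 ->
     partial_sum (fun i => a i * z ^+ wt i) @ totally --> (0 : C)) ->
  a i1 = 0.
Proof.
move=> hwt hz; apply/eqP; apply: contraT => ai1.
have [B B0 hB] : exists2 B, 0 < B &
    forall X : {fset I}, `|\sum_(i <- X) a i| <= B.
  apply: (@partial_sum_bounded _ _ 0).
  have := hz 1; rewrite ltr01 lexx => /(_ isT).
  by under [X in partial_sum X]eq_fun do rewrite expr1n mulr1.
have n0 : 0 < `|a i1| by rewrite normr_gt0.
(* Chosen so that z <= 1 and z * B <= |a i1| / 2, whatever the size of B. *)
pose z : C := `|a i1| / (`|a i1| + 2 * B).
have D0 : 0 < `|a i1| + 2 * B by rewrite addr_gt0 // mulr_gt0.
have z0 : 0 < z by rewrite divr_gt0.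
have z1 : z <= 1 by rewrite ler_pdivrMr // mul1r lerDl mulr_ge0 // ltW.
have zB : z * B <= `|a i1| / 2.
  rewrite /z mulrAC ler_pdivrMr // -mulrA ler_wpM2l //.
  by rewrite ler_pdivlMl // lerDr.
have zw0 : 0 < z ^+ wt i1 by rewrite exprn_gt0.
have := hz z; rewrite z0 z1 => /(_ isT) /cvgrPdist_lt.
move=> /(_ (z ^+ wt i1 * (`|a i1| / 2))).
rewrite mulr_gt0 ?divr_gt0 // => /(_ isT) [X0 _ hX0].
pose X := (i1 |` X0)%fset.
have /hX0 /= : [set Y | (X0 `<=` Y)%fset]%classic X by exact: fsubsetUr.
rewrite sub0r normrN partial_sumE (big_fsetD1 i1) ?fset1U1 //=.
(* The zero terms get weight 0: their exponent may be below that of i1. *)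
pose phi i : C := if (i == i1) || (a i == 0) then 0 else z ^+ (wt i - (wt i1).+1).
have -> : \sum_(i <- (X `\ i1)%fset) a i * z ^+ wt i =
          z ^+ (wt i1).+1 * \sum_(i <- (X `\ i1)%fset) phi i * a i.
  rewrite mulr_sumr; apply: eq_fbigr => i.
  rewrite !inE => /andP[ii1 _] _; rewrite /phi (negPf ii1) /=.
  have [->|ai] := eqVneq (a i) 0; first by rewrite !mul0r mulr0.
  by rewrite mulrA -exprD subnKC ?hwt // mulrC.
have hphi : `|0 + \sum_(i <- (X `\ i1)%fset) phi i * a i| <= B.
  apply: norm_convex_sum_le => [i|s' s's].
    rewrite /phi; case: ifP => _; first by rewrite lexx ler01.
    by rewrite exprn_ge0 ?exprn_ile1 // ltW.
  rewrite add0r.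
  have us' : uniq s' by rewrite (subseq_uniq s's).
  have := hB [fset i in s']%fset.
  by rewrite (perm_big s') // uniq_perm // => i; rewrite !inE.
rewrite add0r in hphi.
set y := \sum_(i <- _) _ in hphi *.
rewrite exprSr -mulrA [a i1 * _]mulrC -mulrDr normrM (ger0_norm (ltW zw0)).
rewrite ltr_pM2l // => hlt.
have : `|a i1| < `|a i1| / 2 + `|a i1| / 2.
  have -> : `|a i1| = `|(a i1 + z * y) - z * y| by congr (`|_|); ring.
  rewrite (le_lt_trans (ler_normB _ _)) //.
  have -> : `|a i1 + z * y - z * y| = `|a i1| by congr (`|_|); ring.
  rewrite ltr_leD // normrM (ger0_norm (ltW z0)).
  by rewrite (le_trans _ zB) // ler_wpM2l // ltW.
by rewrite -splitr ltxx.
Qed.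

(** Convergence of an unordered sum is insensitive to an injective reindexing h,
    as long as the new family vanishes outside the image of h. *)
Lemma cvg_partial_sum_reindex (I J : choiceType) (h : I -> J) (g : J -> I)
    (a : I -> C) (b : J -> C) (l : C) :
  cancel h g -> (forall i, b (h i) = a i) -> (forall j, h (g j) != j -> b j = 0) ->
  partial_sum a @ totally --> l -> partial_sum b @ totally --> l.
Proof.
move=> hK ba b0 al V /al [X0 _ hX0].
exists (h @` X0)%fset => // Y /= X0Y.
pose Z := [fset j in Y | h (g j) == j]%fset.
suff -> : partial_sum b Y = partial_sum a (g @` Z)%fset.
  apply: hX0 => /=; apply/fsubsetP => i iX0.
  apply/imfsetP; exists (h i) => /=; last by rewrite hK.
  by rewrite !inE /= hK eqxx andbT (fsubsetP X0Y) // in_imfset.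
rewrite !partial_sumE eq_big_imfset /=; last first.
  move=> j j' ; rewrite !inE /= => /andP[_ /eqP jK] /andP[_ /eqP j'K] e.
  by rewrite -jK e j'K.
rewrite big_map big_fset /= [LHS](bigID (fun j => h (g j) == j)) /=.
rewrite [X in _ + X]big1 ?addr0; last by move=> j /b0.
by apply: eq_bigr => j /eqP {1}<-.
Qed.

End UnorderedSums.

(** * Uniqueness of power series expansions *)

Lemma base_expansion_inj K d (f g : nat -> nat) :
  (forall i, (i < d)%N -> (f i < K)%N) -> (forall i, (i < d)%N -> (g i < K)%N) ->
  (\sum_(i < d) f i * K ^ i = \sum_(i < d) g i * K ^ i)%N ->
  forall i, (i < d)%N -> f i = g i.
Proof.
elim: d f g => // d IHd f g fK gK.
rewrite !big_ord_recl !expn0 !muln1.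
under eq_bigr do rewrite /bump /= expnS mulnCA.
under [in RHS]eq_bigr do rewrite /bump /= expnS mulnCA.
rewrite -!big_distrr /= => e.
have K0 : (0 < K)%N by rewrite (leq_ltn_trans _ (fK 0%N _)).
have f0 : f 0%N = g 0%N.
  have := congr1 (modn^~ K) e.
  by rewrite !(mulnC K) !(addnC _ (_ * K)%N) !modnMDl !modn_small ?fK ?gK.
move: e; rewrite f0 => /addnI /eqP; rewrite eqn_pmul2l // => /eqP e [//|i] id.
apply: (IHd (fun i => f i.+1) (fun i => g i.+1)) => // j jd.
  exact: fK.
exact: gK.
Qed.

Section PowerSeries.
Local Open Scope classical_set_scope.
Variables (R : realType) (d : nat).
Local Notation C := R[i].
Local Notation series := (multiidx d -> C^o).
Implicit Types (A B : series) (f g : 'rV[C]_d -> C) (t : 'rV[C]_d).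

Definition monomial t (m : multiidx d) : C := \prod_i t 0 i ^+ m i.

Definition series_term A t (m : multiidx d) : C := (A m : C) * monomial t m.

Definition expands A f : Prop :=
  \forall t \near (0 : 'rV[C]_d),
    partial_sum (series_term A t) @ totally --> f t.

Lemma monomial_add1 t m i : monomial t (midx_add1 m i) = t 0 i * monomial t m.
Proof.
rewrite /monomial (bigD1 i) //= [in RHS](bigD1 i) //= mulrA ffunE eqxx addn1.
rewrite exprS; congr (_ * _); apply: eq_bigr => l li.
by rewrite ffunE (negPf li) addn0.
Qed.

Lemma expandsB A B f g :
  expands A f -> expands B g -> expands (A - B) (fun t => f t - g t).
Proof.
move=> hA hB; apply: filterS2 hA hB => t At Bt.
have -> : partial_sum (series_term (A - B) t) =
   (fun X => partial_sum (series_term A t) X -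
             partial_sum (series_term B t) X).
  apply/funext => X; rewrite !partial_sumE -sumrB.
  by apply: eq_bigr => m _; rewrite /series_term -mulrBl.
exact: (cvgB At Bt).
Qed.

Lemma expandsZ x A f : expands A f -> expands (x *: A) (fun t => x * f t).
Proof.
apply: filterS => t At.
have -> : partial_sum (series_term (x *: A) t) =
   (fun X => x * partial_sum (series_term A t) X).
  apply/funext => X; rewrite !partial_sumE mulr_sumr.
  by apply: eq_bigr => m _; rewrite /series_term -mulrA.
exact: (cvgMl_tmp At).
Qed.

Lemma expands0 : expands 0 (fun=> 0).
Proof.
near=> t.
have -> : partial_sum (series_term 0 t) = (fun=> 0 : C).
  apply/funext => X; rewrite partial_sumE big1 // => m _.
  by rewrite /series_term mul0r.
exact: cvg_cst.
Unshelve. all: by end_near. Qed.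

Lemma expands_sum (I : Type) (s : seq I) (A : I -> series) (f : I -> 'rV[C]_d -> C) :
  (forall i, expands (A i) (f i)) ->
  expands (\sum_(i <- s) A i) (fun t => \sum_(i <- s) f i t).
Proof.
move=> hA; elim: s => [|i s IHs].
  rewrite big_nil; under [X in expands _ X]eq_fun do rewrite big_nil.
  exact: expands0.
rewrite big_cons; under [X in expands _ X]eq_fun do rewrite big_cons.
have := expandsB (hA i) (expandsZ (-1) IHs).
rewrite scaleN1r opprK.
by under [X in expands _ X -> _]eq_fun do rewrite mulN1r opprK.
Qed.

(** Multiplying by t_j moves the term of index m to the index m + v_j, and no
    term has an index with vanishing j-th entry. *)
Lemma expands_mulX j A f :
  expands A f -> expands (mulX j A) (fun t => t 0 j * f t).
Proof.
apply: filterS => t At.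
apply: (@cvg_partial_sum_reindex _ _ _ (fun m => midx_add1 m j)
  (fun m => midx_sub1 m j) (fun m => t 0 j * series_term A t m)).
- by move=> m; exact: midx_add1K.
- move=> m; rewrite /series_term /mulX ffunE eqxx addn1 /= midx_add1K monomial_add1.
  by rewrite mulrCA.
- move=> m; rewrite /series_term /mulX; case: ifPn => [mj|_ _]; last exact: mul0r.
  by rewrite midx_sub1K ?eqxx.
have -> : partial_sum (fun m => t 0 j * series_term A t m) =
   (fun X => t 0 j * partial_sum (series_term A t) X).
  by apply/funext => X; rewrite !partial_sumE mulr_sumr.
exact: (cvgMl_tmp At).
Qed.

Lemma expands_affine u A f :
  expands A f -> expands (affine u A) (fun t => (1 - \sum_j u j * t 0 j) * f t).
Proof.
move=> hA; rewrite affineE.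
have -> : (fun t => (1 - \sum_j u j * t 0 j) * f t) =
          (fun t => f t - \sum_j u j * (t 0 j * f t)).
  apply/funext => t; rewrite mulrBl mul1r mulr_suml; congr (_ - _).
  by apply: eq_bigr => j _; rewrite mulrA.
apply: (expandsB hA); apply: expands_sum => j.
apply: expandsZ; exact: expands_mulX.
Qed.

Lemma expands_iter_affine N u A f : expands A f ->
  expands (iter N (affine u) A) (fun t => (1 - \sum_j u j * t 0 j) ^+ N * f t).
Proof.
move=> hA; elim: N => [|N IHN].
  by under [X in expands _ X]eq_fun do rewrite mul1r.
rewrite iterS; under [X in expands _ X]eq_fun do rewrite exprS -mulrA.
exact: expands_affine.
Qed.

Lemma expands_one : expands (@one_series C d) (fun=> 1).
Proof.
near=> t; apply: cvg_near_cst.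
pose m0 : multiidx d := [ffun=> 0%N].
exists [fset m0]%fset => // X /=; rewrite fsub1set => m0X.
rewrite partial_sumE (big_fsetD1 m0) //= big1_seq ?addr0.
  rewrite /series_term /one_series /midx_sum /monomial.
  by rewrite !big1 ?mulr1 // => i _; rewrite ffunE.
move=> m /andP[_]; rewrite !inE => /andP[mm0 _].
rewrite /series_term /one_series; case: eqP => [/eqP|_]; last exact: mul0r.
rewrite /midx_sum sum_nat_eq0 => /forallP m0'; case/eqP: mm0.
by apply/ffunP => i; rewrite ffunE; apply/eqP; exact: m0'.
Unshelve. all: by end_near. Qed.

Lemma expands_affine_prod (U : 'M[C]_d) s :
  expands (affine_prod U s) (fun t => \prod_(l <- s) (1 - \sum_j U l j * t 0 j)).
Proof.
elim: s => [|l s IHs] /=.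
  under [X in expands _ X]eq_fun do rewrite big_nil; exact: expands_one.
under [X in expands _ X]eq_fun do rewrite big_cons.
exact: expands_affine.
Qed.

(** The topology of row vectors is the one of the maximum of the coordinates. *)
Lemma near0_coord (P : 'rV[C]_d -> Prop) :
  (\forall t \near (0 : 'rV[C]_d), P t) ->
  exists2 e : C, 0 < e & forall t, (forall i, `|t 0 i| < e) -> P t.
Proof.
move=> /nbhs_ballP [e e0 he]; exists e => // t te; apply: he.
split=> // i j; rewrite mxE ord1 -ball_normE /= sub0r normrN; exact: te.
Qed.

(** Restrict the expansion to the curve t_i = r z^(L + K^i).  The monomial of
    index m becomes r^|m| z^(L |m| + \sum_i m_i K^i).  Let k be the least degree
    of a nonzero coefficient.  With K = k + 1 the exponents of the monomials of
    degree k are pairwise distinct (their digits in base K differ), and a large L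
    makes them smaller than the exponents of all monomials of higher degree.
    So one nonzero term has the strictly lowest exponent, against
    [leading_coef_eq0]. *)
Lemma expands_unique0 A f :
  (\forall t \near (0 : 'rV[C]_d), f t = 0) -> expands A f -> A = 0.
Proof.
move=> f0 hA.
have {f0 hA} /near0_coord [e e0 hA] : \forall t \near (0 : 'rV[C]_d),
    partial_sum (series_term A t) @ totally --> (0 : C).
  by near=> t; rewrite -(near f0 t) //; near: t.
apply/funext => m; apply: contrapT => /eqP Am.
pose P n := `[< exists2 m', midx_sum m' = n & A m' != 0 >].
have [|k /asboolP[{}m mk {}Am] kmin] := @ex_minnP P.
  by exists (midx_sum m); apply/asboolP; exists m.
pose low (m : multiidx d) := (\sum_(i < d) m i * k.+1 ^ i)%N.
pose Q n := `[< exists2 m', low m' = n & midx_sum m' = k /\ A m' != 0 >].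
have [|n /asboolP[m1 m1n [m1k Am1]] nmin] := @ex_minnP Q.
  by exists (low m); apply/asboolP; exists m.
(* L exceeds every base k.+1 value of a multi-index of degree k. *)
pose L := (k * k.+1 ^ d).+1.
pose wt m := (L * midx_sum m + low m)%N.
have digit m' : midx_sum m' = k -> forall i, (m' i < k.+1)%N.
  by move=> <- i; rewrite ltnS /midx_sum (bigD1 i) //= leq_addr.
pose r := e / 2; have r0 : 0 < r by rewrite divr_gt0.
suff : A m1 * r ^+ midx_sum m1 = 0.
  by move/eqP; rewrite mulf_eq0 (negPf Am1) expf_eq0 gt_eqF // andbF.
apply: (@leading_coef_eq0 R _ (fun m => A m * r ^+ midx_sum m) wt)
  => [m' m'1|z /andP[z0 z1]].
  rewrite mulf_eq0 negb_or => /andP[Am' _].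
  have : (k <= midx_sum m')%N by apply: kmin; apply/asboolP; exists m'.
  rewrite leq_eqVlt => /orP[/eqP km'|km'].
    rewrite /wt m1k -km' ltn_add2l ltn_neqAle; apply/andP; split; last first.
      by rewrite m1n; apply: nmin; apply/asboolP; exists m'.
    apply: contra_neq m'1 => lowE; apply/ffunP => i.
    have := @base_expansion_inj k.+1 d
      (fun j => if insub j is Some j then m1 j else 0%N)
      (fun j => if insub j is Some j then m' j else 0%N).
    move=> /(_ _ _ _ i (ltn_ord i)); rewrite valK => -> //.
    - by move=> j jd; rewrite insubT digit.
    - by move=> j jd; rewrite insubT digit.
    by under eq_bigr do rewrite valK; under [RHS]eq_bigr do rewrite valK.
  have lowlt : (low m1 < L)%N.
    rewrite ltnS -{1}m1k /midx_sum big_distrl /=; apply: leq_sum => i _.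
    by rewrite leq_mul2l leq_pexp2l ?orbT // ltnW.
  rewrite /wt m1k (leq_trans (n := (L * k.+1)%N)) //.
    by rewrite mulnS addnC ltn_add2r.
  by rewrite (leq_trans _ (leq_addr _ _)) // leq_mul2l km' orbT.
pose t : 'rV[C]_d := \row_i (r * z ^+ (L + k.+1 ^ i)).
have -> : (fun m => A m * r ^+ midx_sum m * z ^+ wt m) =
          (series_term A t).
  apply/funext => m'; rewrite -mulrA; congr (_ * _).
  rewrite /monomial; under [RHS]eq_bigr do rewrite mxE exprMn -exprM.
  rewrite big_split /= !prodrXr /wt /low /midx_sum; congr (_ * _ ^+ _).
  rewrite big_distrr -big_split /=; apply: eq_bigr => i _.
  by rewrite mulnDl [(m' i * _)%N]mulnC.
apply: hA => i; rewrite mxE ger0_norm; last first.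
  by rewrite mulr_ge0 ?exprn_ge0 // ltW.
rewrite (@le_lt_trans _ _ r) //; last first.
  by rewrite ltr_pdivrMr // ltr_pMr // ltr1n.
by rewrite ler_piMr ?exprn_ile1 // ltW.
Unshelve. all: by end_near. Qed.

End PowerSeries.

(** * Integer exponents in the principal power *)

Section PrincipalPowerNat.
Variable R : realType.
Local Notation C := R[i].
Implicit Types (z w : C).

Lemma cexpD z w : cexp (z + w) = cexp z * cexp w.
Proof.
case: z w => [x y] [x' y']; apply/eqP; rewrite eq_complex /= expRD cosD sinD.
by apply/andP; split; apply/eqP; ring.
Qed.

Lemma cexp0 : cexp (0 : C) = 1.
Proof. by rewrite /cexp /= expR0 cos0 sin0 mulr1 mulr0. Qed.

Lemma cexpMn z n : cexp (n%:R * z) = cexp z ^+ n.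
Proof.
elim: n => [|n IHn]; first by rewrite mul0r cexp0.
by rewrite exprS -IHn -cexpD mulrS mulrDl mul1r.
Qed.

Lemma cexpNMn z n : cexp (- n%:R * z) = (cexp z ^+ n)^-1.
Proof.
have h : cexp (- n%:R * z) * cexp z ^+ n = 1.
  by rewrite -cexpMn -cexpD mulNr addNr cexp0.
have nz : cexp z ^+ n != 0.
  by apply: contraTneq isT => e; move/eqP: h; rewrite e mulr0 eq_sym oner_eq0.
by apply: (mulIf nz); rewrite h mulVf.
Qed.

(** acos recovers the argument of a point in the upper half plane, and its
    opposite the one of a point in the lower half plane. *)
Lemma clogK w : w != 0 -> cexp (clog w) = w.
Proof.
case: w => x y; rewrite eq_complex /= => xy0.
have s0 : 0 < x ^+ 2 + y ^+ 2.
  rewrite lt_neqAle addr_ge0 ?sqr_ge0 // andbT eq_sym.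
  by rewrite paddr_eq0 ?sqr_ge0 // !sqrf_eq0.
rewrite /clog /cexp lnK /=; last by rewrite posrE sqrtr_gt0.
set r := Num.sqrt _; have r0 : 0 < r by rewrite sqrtr_gt0.
have r2 : r ^+ 2 = x ^+ 2 + y ^+ 2 by rewrite sqr_sqrtr // ltW.
have xr : `|x / r| <= 1.
  rewrite normrM normfV (gtr0_norm r0) ler_pdivrMr // mul1r.
  by rewrite -sqrtr_sqr ler_wsqrtr // lerDl sqr_ge0.
have xr' : x / r \in `[(-1)%R, 1%R]%R by rewrite in_itv /= -ler_norml.
have sE : sin (acos (x / r)) = `|y| / r.
  rewrite sin_acos -?ler_norml //.
  have -> : 1 - (x / r) ^+ 2 = (y / r) ^+ 2.
    rewrite !expr_div_n r2 -[1](@divff _ (x ^+ 2 + y ^+ 2)) ?gt_eqF //.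
    by rewrite -mulrBl addrAC subrr add0r.
  by rewrite sqrtr_sqr normrM normfV (gtr0_norm r0).
have rK u : r * (u / r) = u by rewrite mulrC divfK ?gt_eqF.
apply/eqP; rewrite eq_complex /=; case: (leP 0 y) => y0.
  by rewrite acosK // sE ger0_norm // !rK !eqxx.
by rewrite cosN sinN acosK // sE ltr0_norm // mulNr opprK !rK !eqxx.
Qed.

Lemma cpow_nat w n : w != 0 -> cpow w n%:R = w ^+ n.
Proof. by move=> w0; rewrite /cpow cexpMn clogK. Qed.

Lemma cpow_oppnat w n : w != 0 -> cpow w (- n%:R) = (w ^+ n)^-1.
Proof. by move=> w0; rewrite /cpow cexpNMn clogK. Qed.

End PrincipalPowerNat.

(** * Columns of an element of SU(1,d) *)

Section SU1d.
Variables (R : realType) (d : nat).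
Local Notation C := R[i].

(** Entries of g^t* J g = J: the pairing of the column k + 1 with the column 0,
    then with the column l + 1. *)
Lemma in_SU1d_columns (a : C) (b c : 'cV[C]_d) (D : 'M[C]_d) :
  in_SU1d (block_mx a%:M b^T c D) ->
  (forall k, \sum_j Num.conj (D j k) * c j 0 = Num.conj (b k 0) * a) /\
  (forall k l, \sum_j Num.conj (D j k) * D j l =
     Num.conj (b k 0) * b l 0 + (k == l)%:R).
Proof.
case=> _; rewrite /J1d tr_block_mx map_block_mx !mulmx_block.
rewrite !mulmx0 !mulmx1 !addr0 !add0r !mulmxN !mulmx1 !mulNmx.
move=> /eq_block_mx[_ _ e0 e1]; split=> [k|k l].
  move/matrixP/(_ k 0): e0; rewrite !mxE big_ord1 !mxE mulr1n => /eqP.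
  rewrite subr_eq0 => /eqP ->; apply: eq_bigr => j _; by rewrite !mxE.
move/matrixP/(_ k l): e1; rewrite !mxE big_ord1 !mxE => /eqP.
rewrite subr_eq addrC => /eqP ->; rewrite addrNK.
by apply: eq_bigr => j _; rewrite !mxE.
Qed.

End SU1d.

(** * From the differential equation to the recurrence *)

Section MeixnerCoefficients.
Variables (R : realType) (d : nat).
Local Notation C := R[i].

Implicit Types (beta : C) (m : multiidx d) (j : 'I_d).

(** The factor of M_m in the coefficient of t^m of the generating function. *)
Definition genfun_weight (beta : C) (m : multiidx d) : C :=
  pochhammer beta (midx_sum m) / (midx_fact m)%:R.

Lemma genfun_weight_add1 beta m j :
  (m j).+1%:R * genfun_weight beta (midx_add1 m j) =
  (beta + (midx_sum m)%:R) * genfun_weight beta m.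
Proof.
rewrite /genfun_weight midx_sum_add1 midx_fact_add1 /pochhammer big_nat_recr //=.
rewrite natrM; field.
by rewrite nat1r !pnatr_eq0 /= -lt0n midx_fact_gt0.
Qed.

Lemma genfun_weight_sub1 beta m j : (0 < m j)%N ->
  (beta + (midx_sum (midx_sub1 m j))%:R) * genfun_weight beta (midx_sub1 m j) =
  (m j)%:R * genfun_weight beta m.
Proof.
move=> mj; rewrite -(genfun_weight_add1 _ _ j) midx_sub1K //.
by rewrite ffunE eqxx subn1 prednK.
Qed.

Lemma genfun_weight_neq0 (sigma : nat) m :
  (0 < sigma)%N -> genfun_weight sigma%:R m != 0.
Proof.
move=> s0; rewrite mulf_neq0 ?invr_eq0 ?pnatr_eq0 -?lt0n ?midx_fact_gt0 //.
rewrite /pochhammer prodf_seq_neq0; apply/allP => i _ /=.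
by rewrite -natrD pnatr_eq0 addn_eq0 negb_and -lt0n s0.
Qed.

(** Coefficient of t^m in L_k (Delta + sigma) G = kappa c G.  The coefficient of
    t^l in (Delta + sigma) G is (sigma + |l|) (sigma)_|l| / l! times
    M_l - \sum_j w_j M_(l + v_j), so (sigma)_|m| / m! factors out of the whole
    equation. *)
Lemma recurrence_of_drift_eq (sigma : nat) (w : 'I_d -> C) (U : 'M[C]_d)
    (kappa : C) (k : 'I_d) (c : nat) (M : multiidx d -> C) m :
  (0 < sigma)%N ->
  let A : multiidx d -> C^o := fun l => genfun_weight sigma%:R l * M l in
  affine (U k) (euler_drift w A + A *+ sigma) = kappa *: A *+ c ->
  kappa * c%:R * M m =
    (sigma%:R + (midx_sum m)%:R) * (M m - \sum_j w j * M (midx_add1 m j))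
    - \sum_i U k i * (m i)%:R *
        (M (midx_sub1 m i) - \sum_j w j * M (midx_add1 (midx_sub1 m i) j)).
Proof.
move=> s0 A /(congr1 (fun f => f m)).
pose q := genfun_weight sigma%:R.
pose Y l := M l - \sum_j w j * M (midx_add1 l j).
have XE l : (euler_drift w A + A *+ sigma) l =
    (sigma%:R + (midx_sum l)%:R) * q l * Y l.
  have -> : (euler_drift w A + A *+ sigma) l = euler_drift w A l + A l *+ sigma.
    by elim: (sigma) => // n IHn; rewrite mulrSr addrA mulrSr addrA -IHn.
  rewrite /euler_drift /A /Y.
  under eq_bigr do rewrite -mulrA [_.+1%:R * _]mulrA genfun_weight_add1 mulrCA.
  rewrite -mulr_sumr -/(q l) -mulr_natl; ring.
rewrite {1}/affine XE.
have -> : (kappa *: A *+ c) m = kappa * c%:R * (q m * M m).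
  have -> : (kappa *: A *+ c) m = (kappa * A m) *+ c.
    by elim: (c) => // n IHn; rewrite !mulrSr -IHn.
  by rewrite mulrAC mulr_natr.
have -> : \sum_(j < d) U k j * mulX j (euler_drift w A + A *+ sigma) m =
    q m * \sum_i U k i * (m i)%:R * Y (midx_sub1 m i).
  rewrite mulr_sumr; apply: eq_bigr => i _; rewrite /mulX; case: ifPn => mi.
    by rewrite XE genfun_weight_sub1 // /q; ring.
  by move: mi; rewrite -eqn0Ngt => /eqP ->; rewrite !(mulr0, mul0r).
move=> e; apply: (mulfI (genfun_weight_neq0 m s0)); rewrite -/(q m) -/(Y m).
rewrite [LHS]mulrCA -e [RHS]mulrBr; congr (_ - _).
by rewrite [RHS]mulrA [q m * _]mulrC.
Qed.

(** The terms i = j of the double sum, where m - v_i + v_i = m, are collected in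
    the factor of M_m. *)
Lemma recurrence_expand (s : C) (u v : 'I_d -> C) (M : multiidx d -> C) m :
  s * (M m - \sum_j v j * M (midx_add1 m j))
    - \sum_i u i * (m i)%:R *
        (M (midx_sub1 m i) - \sum_j v j * M (midx_add1 (midx_sub1 m i) j)) =
  (s + \sum_i u i * v i * (m i)%:R) * M m
  + \sum_i \sum_(j | i != j) v i * u j * (m j)%:R * M (midx_add1 (midx_sub1 m j) i)
  - \sum_i u i * (m i)%:R * M (midx_sub1 m i)
  - s * \sum_j v j * M (midx_add1 m j).
Proof.
have -> : \sum_i u i * (m i)%:R *
      (M (midx_sub1 m i) - \sum_j v j * M (midx_add1 (midx_sub1 m i) j)) =
    \sum_i u i * (m i)%:R * M (midx_sub1 m i) -
    \sum_i (u i * v i * (m i)%:R * M m + \sum_(j | i != j)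
      v i * u j * (m j)%:R * M (midx_add1 (midx_sub1 m j) i)).
  under eq_bigr do rewrite mulrBr mulr_sumr.
  rewrite sumrB exchange_big /=; congr (_ - _); apply: eq_bigr => i _.
  rewrite (bigD1 i) //=; congr (_ + _).
    case: (posnP (m i)) => mi; first by rewrite mi !(mulr0, mul0r).
    by rewrite midx_sub1K //; ring.
  by apply: eq_big => [j|j _]; [rewrite eq_sym|ring].
by rewrite big_split /= -mulr_suml; ring.
Qed.

End MeixnerCoefficients.

(** * The generating function at an integral point *)

Section GeneratingFunction.
Local Open Scope classical_set_scope.
Variables (R : realType) (d : nat).
Local Notation C := R[i].

(** The base points of the principal powers stay away from 0 near the origin. *)
Lemma near_affine_neq0 (u : 'I_d -> C) :
  \forall t \near (0 : 'rV[C]_d), 1 - \sum_j u j * (t : 'rV[C]_d) 0 j != 0.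
Proof.
pose B := 1 + \sum_j `|u j|.
have B0 : 0 < B by rewrite ltr_pwDl // sumr_ge0.
apply/nbhs_ballP; exists B^-1; first by rewrite /= invr_gt0.
move=> t [_ tB]; rewrite subr_eq0; apply: contraTneq isT => e.
suff : `|\sum_j u j * t 0 j| < 1 by rewrite -e normr1 ltxx.
apply: (@le_lt_trans _ _ ((\sum_j `|u j|) / B)); last first.
  by rewrite ltr_pdivrMr // mul1r ltrDr.
rewrite (le_trans (ler_norm_sum _ _ _)) // mulr_suml ler_sum // => j _.
rewrite normrM ler_wpM2l // ltW //.
by have := tB 0 j; rewrite mxE -ball_normE /= sub0r normrN.
Qed.

(** Turns the exponents of \prod_i L_i^n_i into multiplicities, as
    [affine_prod] expects. *)
Definition index_list (n : multiidx d) : seq 'I_d :=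
  flatten [seq nseq (n i) i | i <- index_enum 'I_d].

Lemma size_index_list n : size (index_list n) = midx_sum n.
Proof.
rewrite size_flatten /shape -map_comp sumnE big_map /midx_sum.
by apply: eq_bigr => i _; rewrite /= size_nseq.
Qed.

Lemma count_index_list n k : count_mem k (index_list n) = n k.
Proof.
rewrite count_flatten -map_comp sumnE big_map (bigD1 k) //= count_nseq /= eqxx.
by rewrite mul1n big1 ?addn0 // => i ik; rewrite count_nseq /= (negPf ik).
Qed.

Lemma prod_index_list n (F : 'I_d -> C) :
  \prod_(l <- index_list n) F l = \prod_i F i ^+ n i.
Proof.
rewrite big_flatten big_map; apply: eq_bigr => i _.
by rewrite big_nseq -Monoid.iteropE.
Qed.

Lemma meixner_genfun_nat (U : 'M[C]_d) (sigma : nat) (n : multiidx d) (t : 'rV[C]_d) :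
  1 - \sum_j t 0 j != 0 -> (forall i, 1 - \sum_j U i j * t 0 j != 0) ->
  meixner_genfun U sigma%:R (midx_point R n) t =
    (1 - \sum_j t 0 j) ^- (sigma + midx_sum n) *
    \prod_i (1 - \sum_j U i j * t 0 j) ^+ n i.
Proof.
move=> t0 tU; rewrite /meixner_genfun.
have -> : - sigma%:R - \sum_i midx_point R n 0 i = - (sigma + midx_sum n)%:R :> C.
  rewrite natrD opprD /midx_sum natr_sum; congr (_ - _).
  by apply: eq_bigr => i _; rewrite mxE.
rewrite cpow_oppnat //; congr (_ * _); apply: eq_bigr => i _.
by rewrite mxE cpow_nat.
Qed.

(** Near the origin S^N G and \prod_i L_i^n_i are the same function; uniqueness
    of expansions turns this into an identity between coefficients. *)
Lemma iter_affine_meixner (U : 'M[C]_d) (sigma : nat)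
    (M : multiidx d -> 'rV[C]_d -> C) (n : multiidx d) :
  is_meixner U sigma%:R M ->
  iter (sigma + midx_sum n) (affine (fun=> 1))
    ((fun m => genfun_weight sigma%:R m * M m (midx_point R n))
       : multiidx d -> C^o) =
  affine_prod U (index_list n).
Proof.
move=> hM; set A : multiidx d -> C^o := fun m => _.
have hA : expands A (meixner_genfun U sigma%:R (midx_point R n)).
  exact: hM.
have h := expandsB (expands_iter_affine (sigma + midx_sum n) (fun=> 1) hA)
  (expands_affine_prod U (index_list n)).
apply/eqP; rewrite -subr_eq0; apply/eqP; apply: expands_unique0 h.
have hU : \forall t \near (0 : 'rV[C]_d), forall i,
    1 - \sum_j U i j * (t : 'rV[C]_d) 0 j != 0.
  apply: (@filter_forall _ _ _ (nbhs (0 : 'rV[C]_d))) => i.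
  exact: near_affine_neq0.
near=> t.
have t1 : 1 - \sum_j 1 * t 0 j != 0.
  by near: t; exact: (near_affine_neq0 (fun=> 1)).
have tU i : 1 - \sum_j U i j * t 0 j != 0 by move: i; near: t.
have e1 : \sum_j 1 * t 0 j = \sum_j t 0 j.
  by apply: eq_bigr => j _; rewrite mul1r.
rewrite e1 in t1 *; rewrite meixner_genfun_nat // prod_index_list mulrA.
by rewrite divff ?expf_neq0 // mul1r subrr.
Unshelve. all: by end_near. Qed.

End GeneratingFunction.

(** * The recurrence of the Meixner polynomials *)

Theorem theorem4p3 (R : realType) (d sigma : nat)
    (hd : (1 <= d)%N) (hsigma : (d + 1 <= sigma)%N)
    (a : R[i]) (b c : 'cV[R[i]]_d) (D : 'M[R[i]]_d)
    (hg : in_SU1d (block_mx a%:M b^T c D))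
    (ha : a != 0) (hb : forall i, b i 0 != 0) (hc : forall i, c i 0 != 0)
    (p ptilde : 'I_d -> R[i]) (U : 'M[R[i]]_d) (p0 : R[i])
    (hp : forall i, p i = b i 0 / a)
    (hptilde : forall i, ptilde i = c i 0 / a)
    (hU : forall i j, U i j = a * D j i / (b i 0 * c j 0))
    (hp0 : `|p0| ^+ 2 = `|a| ^- 2)
    (M : multiidx d -> 'rV[R[i]]_d -> R[i])
    (hM : is_meixner U sigma%:R M)
    (k : 'I_d) (m n : multiidx d) :
  let Mn (l : multiidx d) := M l (midx_point R n) in
  `|p0 / p k| ^+ 2 * (n k)%:R * Mn m =
    (sigma%:R + (midx_sum m)%:R
       + \sum_i `|U k i * ptilde i| ^+ 2 * (m i)%:R) * Mn m
    + \sum_i \sum_(j | i != j)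
        Num.conj (U k i) * U k j * `|ptilde i| ^+ 2 * (m j)%:R
        * Mn (midx_add1 (midx_sub1 m j) i)
    - \sum_i U k i * (m i)%:R * Mn (midx_sub1 m i)
    - (sigma%:R + (midx_sum m)%:R)
      * \sum_i Num.conj (U k i) * `|ptilde i| ^+ 2 * Mn (midx_add1 m i).
Proof.
move=> Mn.
have [ec eD] := in_SU1d_columns hg.
pose w i := Num.conj (U k i) * `|ptilde i| ^+ 2.
have cb : Num.conj (b k 0) != 0 by rewrite conjC_eq0.
have ca : Num.conj a != 0 by rewrite conjC_eq0.
(* The relation between the columns 0 and k + 1 of g gives \sum_j w_j = 1. *)
have wE i : w i = Num.conj (D i k) * c i 0 / (Num.conj (b k 0) * a).
  have cc : Num.conj (c i 0) != 0 by rewrite conjC_eq0.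
  rewrite /w hU hptilde normCK !(rmorphM, fmorphV) /=; field.
  by rewrite ca ha cb cc.
have w1 : \sum_j w j = 1.
  under eq_bigr do rewrite wE.
  by rewrite -mulr_suml ec divff // mulf_neq0.
have kappaE : `|p0 / p k| ^+ 2 = (b k 0 * Num.conj (b k 0))^-1.
  rewrite normrM exprMn hp0 normfV hp normrM normfV exprVn exprMn exprVn -normCK.
  have : `|a| != 0 by rewrite normr_eq0.
  have : `|b k 0| != 0 by rewrite normr_eq0.
  by move: `|a| `|b k 0| => x y y0 x0; field; rewrite x0 y0.
(* The one between the columns l + 1 and k + 1 gives the other hypothesis. *)
have Uw l : \sum_j U l j * w j = 1 + `|p0 / p k| ^+ 2 *+ (l == k).
  have -> : \sum_j U l j * w j =
      (\sum_j Num.conj (D j k) * D j l) / (Num.conj (b k 0) * b l 0).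
    rewrite mulr_suml; apply: eq_bigr => j _; rewrite hU wE; field.
    by rewrite cb hb hc ha.
  rewrite eD mulrDl divff ?mulf_neq0 // kappaE eq_sym; congr (_ + _).
  by case: eqVneq => [->|_]; rewrite ?mul0r // mul1r mulrC.
have sigma0 : (0 < sigma)%N by apply: leq_trans hsigma; rewrite addn1.
have hA := iter_affine_meixner n hM.
rewrite -size_index_list in hA.
have := drift_eq_of_product w1 Uw hA.
rewrite count_index_list.
move=> /(@recurrence_of_drift_eq _ _ sigma w U _ k (n k) Mn m sigma0) ->.
rewrite recurrence_expand; congr (_ + _ - _ - _ * _).
- congr ((_ + _) * _); apply: eq_bigr => i _.
  by rewrite /w normrM exprMn [in RHS]normCK !mulrA.
- apply: eq_bigr => i _; apply: eq_bigr => j _.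
  by rewrite /w; congr (_ * _ * _); rewrite mulrAC.
Qed.
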